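(* Let $G$ be a finite nonabelian group. The following conditions on $G$ are equivalent: (1) $G$ has a $2$-abelian partition with respect to an abelian subgroup $A$. (2) $G=P\times Q$, where $P\in \mathrm{Syl}_2(G)$ with $P/Z(P)\cong \mathbb{Z}_2\times\mathbb{Z}_2$ and $Q$ is abelian, and $A=\langle Z(G), t\rangle$, where $t$ is an involution outside of $Z(G)$.
   Context: $Z(\cdot)$ denotes the center and $\mathrm{Syl}_2(G)$ the set of Sylow $2$-subgroups of $G$. A subset $X$ of a group is commuting if any two of its elements commute. Let $G$ be a nonabelian group, $A\subseteq G$ an abelian subgroup and $n\ge 2$ an integer. $G$ has an $n$-abelian partition with respect to $A$ if $G$ is the disjoint union $G=A\uplus A_1\uplus\cdots\uplus A_n$ of $A$ and $n$ commuting subsets $A_1,\dots,A_n$ of $G$ with $|A_i|>1$ for each $i$.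
   Formalization: ''t is an involution outside of Z(G)'' is read as: t lies in G outside Z(G) and its image in G/Z(G) has order 2; with t itself of order 2 the claim fails for the quaternion group Q_8, partitioned as {±1,±i}, {±j}, {±k}. *)

(* Defs.v *)
From mathcomp Require Import all_boot all_fingroup zmodp all_solvable.

Set Implicit Arguments.
Unset Strict Implicit.
Unset Printing Implicit Defensive.

Local Open Scope group_scope.

Definition commuting_set (gT : finGroupType) (X : {set gT}) : Prop :=
  {in X &, forall x y, commute x y}.

Definition n_abelian_partition (gT : finGroupType) (n : nat)
    (G A : {group gT}) : Prop :=
  [/\ (2 <= n)%N, A \subset G, abelian A
    & exists B : 'I_n -> {set gT},
      [/\ forall i, commuting_set (B i),
          forall i, (1 < #|B i|)%N,
          forall i, [disjoint A & B i],
          forall i j, i != j -> [disjoint B i & B j]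
        & G :=: A :|: \bigcup_(i < n) B i]].

(* "Involution outside of the center" is read modulo the center: the image of
   t in G / 'Z(G) is an involution.  Asking for #[t] = 2 instead would make
   the characterization of 2-abelian partitions fail for the quaternion group,
   {1,-1,i,-i} + {j,-j} + {k,-k}, whose only involution is central. *)
Definition involution_mod_center (gT : finGroupType) (G : {group gT})
    (t : gT) : Prop :=
  [/\ t \in G, t \notin 'Z(G) & #[coset 'Z(G) t] = 2%N].

(* Main.v *)
Require Import Defs.
From mathcomp Require Import all_boot all_fingroup zmodp all_solvable.

Set Implicit Arguments.
Unset Strict Implicit.
Unset Printing Implicit Defensive.

Local Open Scope group_scope.

(* Suppose G = A + B1 + B2 is a partition as above. Then G is the union of the
   abelian, hence proper, subgroups A, <B1> and <B2>. No group is the union of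
   two proper subgroups, so a pairwise intersection of the three lies in the
   third and has index at most 2 in each of them; therefore
   K = A :&: <B1> :&: <B2> has index at most 4 in G. Since K is centralised by
   the three subgroups, it is central, and as G / 'Z(G) is not cyclic, K = 'Z(G)
   and G / 'Z(G) has order 4. Then G is nilpotent with central 2'-part.
   Conversely, if G / 'Z(G) has order 4, the blocks B1 and B2 can be taken to be
   the two cosets of 'Z(G) outside A. *)

(** * Covers of a group by two or three proper subgroups *)

Section SubgroupCovers.

Variable gT : finGroupType.
Implicit Types G H K : {group gT}.

(** If [x] avoids [H] but lies in [K], and [y] avoids [K] but lies in [H], then [x * y] avoids
    both. *)
Lemma exists_outside_two_subgroups G H K :
  H \proper G -> K \proper G -> exists x, [/\ x \in G, x \notin H & x \notin K].
Proof.
move=> /properP[sHG [x Gx nHx]] /properP[sKG [y Gy nKy]].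
have [Kx|nKx] := boolP (x \in K); last by exists x.
have [Hy|nHy] := boolP (y \in H); last by exists y.
by exists (x * y); split; [apply: groupM | rewrite groupMr | rewrite groupMl].
Qed.

(** Some [y] lies in [H3] only. For [z] in [H1 :&: H2] the product [z * y] still avoids [H1] and
    [H2], hence lies in [H3], and cancelling [y] puts [z] in [H3]. *)
Lemma three_cover_capS G H1 H2 H3 :
    H1 \proper G -> H2 \proper G -> G \subset H1 :|: H2 :|: H3 ->
  H1 :&: H2 \subset H3.
Proof.
move=> pH1 pH2 sGH.
have [y [Gy nH1y nH2y]] := exists_outside_two_subgroups pH1 pH2.
have in3 x : x \in G -> x \notin H1 -> x \notin H2 -> x \in H3.
  by move=> /(subsetP sGH); rewrite !inE => /orP[/orP[]|] -> //.
apply/subsetP=> z /setIP[H1z H2z].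
have Gz : z \in G by apply: (subsetP (proper_sub pH1)).
have H3y := in3 y Gy nH1y nH2y.
by rewrite -(groupMr z H3y) in3 ?(groupMl y H1z, groupMl y H2z) // groupM.
Qed.

(** Take [x] in [H1] only and [y] in [H2] only. Right multiplication by [y] sends [H1 :\: H2] into
    [H3], so two elements of [H1 :\: H2] differ by an element of [H1 :&: H3], which lies in [H2].
    Hence [H1 :\: H2] fits in the single coset of [x]. *)
Lemma three_cover_card G H1 H2 H3 :
    H1 \proper G -> H2 \proper G -> H3 \proper G ->
    G \subset H1 :|: H2 :|: H3 ->
  #|H1| <= 2 * #|H1 :&: H2|.
Proof.
move=> pH1 pH2 pH3 sGH.
have sH13 : H1 :&: H3 \subset H2.
  by apply: three_cover_capS pH1 pH3 _; rewrite setUAC.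
have inGH x : x \in G -> [|| x \in H1, x \in H2 | x \in H3].
  by move/(subsetP sGH); rewrite !inE orbA.
have [x [Gx nH2x nH3x]] := exists_outside_two_subgroups pH2 pH3.
have [y [Gy nH1y nH3y]] := exists_outside_two_subgroups pH1 pH3.
have H1x : x \in H1.
  by have := inGH x Gx; rewrite (negPf nH2x) (negPf nH3x) !orbF.
have H2y : y \in H2.
  by have := inGH y Gy; rewrite (negPf nH1y) (negPf nH3y) orbF.
(* Exactly one factor lies in [H1] and exactly one in [H2], so the product avoids both. *)
have H3M h : h \in H1 -> h \notin H2 -> h * y \in H3.
  move=> H1h nH2h; have Gh := subsetP (proper_sub pH1) h H1h.
  have := inGH _ (groupM Gh Gy).
  by rewrite groupMl // groupMr // (negPf nH1y) (negPf nH2h).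
have sH1 : H1 \subset (H1 :&: H2) :|: (H1 :&: H2) :* x.
  apply/subsetP=> h H1h; rewrite in_setU mem_rcoset !in_setI H1h.
  have [//|nH2h /=] := boolP (h \in H2).
  have H1hx : h * x^-1 \in H1 by rewrite groupM ?groupV.
  rewrite H1hx (subsetP sH13) // inE H1hx.
  have -> : h * x^-1 = (h * y) * (x * y)^-1 by rewrite invMg mulgA mulgK.
  by rewrite groupM ?groupV ?H3M.
apply: leq_trans (subset_leq_card sH1) _.
by rewrite (leq_trans (leq_card_setU _ _)) // card_rcoset mul2n addnn.
Qed.

(** The three pairwise intersections coincide with one subgroup [K]. Each subgroup adds at most
    [#|K|] elements outside [K], so [G] has at most [(1 + 3) * #|K|] elements. *)
Lemma three_cover_card_group G H1 H2 H3 :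
    H1 \proper G -> H2 \proper G -> H3 \proper G ->
    G \subset H1 :|: H2 :|: H3 ->
  #|G| <= 4 * #|H1 :&: H2|.
Proof.
move=> pH1 pH2 pH3 sGH.
have sK3 := three_cover_capS pH1 pH2 sGH.
have sG23 : G \subset H2 :|: H3 :|: H1 by rewrite setUC setUA.
have sG31 : G \subset H3 :|: H1 :|: H2 by rewrite -setUA setUC.
have eq23 : H2 :&: H3 = H1 :&: H2.
  apply/eqP; rewrite eqEsubset !subsetI subsetIl subsetIr sK3 !andbT.
  exact: three_cover_capS pH2 pH3 sG23.
have eq31 : H3 :&: H1 = H1 :&: H2.
  apply/eqP; rewrite eqEsubset !subsetI subsetIl subsetIr sK3 !andbT.
  exact: three_cover_capS pH3 pH1 sG31.
have c1 := three_cover_card pH1 pH2 pH3 sGH.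
have := three_cover_card pH2 pH3 pH1 sG23; rewrite eq23 => c2.
have := three_cover_card pH3 pH1 pH2 sG31; rewrite eq31 => c3.
set K := H1 :&: H2 in eq23 eq31 c1 c2 c3 *.
have cD H : K \subset H -> #|H| <= 2 * #|K| -> #|H :\: K| <= #|K|.
  by move=> sKH; rewrite cardsDS // leq_subLR mul2n addnn.
have sG : G \subset K :|: (H1 :\: K) :|: ((H2 :\: K) :|: (H3 :\: K)).
  apply: subset_trans sGH _; apply/subsetP=> x; rewrite !in_setU !in_setD.
  by case: (x \in K) => //=; rewrite orbA.
apply: leq_trans (subset_leq_card sG) _.
rewrite (leq_trans (leq_card_setU _ _)) // (_ : 4 = 2 + 2) // mulnDl.
apply: leq_add; rewrite (leq_trans (leq_card_setU _ _)) // mul2n -addnn.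
  by rewrite leq_add ?cD ?subsetIl.
by rewrite leq_add ?cD ?subsetIr.
Qed.

End SubgroupCovers.

(** Without elements of order 4 the group has exponent 2, and elementary abelian 2-groups are
    classified by their order. *)
Lemma isog_Z2xZ2 (gT : finGroupType) (G : {group gT}) :
  ~~ cyclic G -> #|G| = 4 -> G \isog [set: 'Z_2 * 'Z_2].
Proof.
move=> ncG cG; have pG : 2.-group G by rewrite /pgroup cG.
have abG : 2.-abelem G.
  apply/abelemP => //; split; first by rewrite (p2group_abelian pG) ?cG.
  move=> x Gx; apply/eqP; rewrite -order_dvdn.
  have := order_dvdG Gx; rewrite cG.
  have: #[x] != 4.
    apply: contra ncG => /eqP ox; apply/cyclicP; exists x; apply/eqP.
    by rewrite eq_sym eqEcard cycle_subG Gx cG -ox /=.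
  by have := order_gt0 x; case: #[x] => [|[|[|[|[|n]]]]].
rewrite (isog_abelem_card _ abG) cG cardsT card_prod !card_ord eqxx andbT.
apply/abelemP => //; split.
  by apply/centsP=> -[a b] _ [c d] _; congr (_, _); exact: Zp_mulgC.
by case=> [[[|[|a]] ?] [[|[|b]] ?]] _; apply/eqP.
Qed.

(** * Groups whose central quotient has order 4 *)

Section CenterIndexFour.

Variable gT : finGroupType.
Implicit Types G A P Q : {group gT}.

Lemma card_center_quotient G : (#|'Z(G)| * #|G / 'Z(G)|)%N = #|G|.
Proof.
by rewrite card_quotient ?gFnorm // Lagrange ?center_sub.
Qed.

(** Groups of order at most 3 are cyclic, and a cyclic central quotient forces commutativity. *)
Lemma card_center_quotient_gt3 G : ~~ abelian G -> 3 < #|G / 'Z(G)|.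
Proof.
apply: contraR => le3; apply: cyclic_center_factor_abelian.
have := cardG_gt0 (G / 'Z(G)).
case E: #|G / 'Z(G)| le3 => [|[|[|[|n]]]] // _ _.
- by rewrite (card1_trivg E) cyclic1.
- by rewrite prime_cyclic ?E.
- by rewrite prime_cyclic ?E.
Qed.

(** As [Q] is abelian, ['Z(G)] is the direct product of ['Z(P)] and [Q], so the factor [#|Q|]
    cancels. *)
Lemma card_quotient_center_dprod G P Q :
  P \x Q = G -> abelian Q -> #|P / 'Z(P)| = #|G / 'Z(G)|.
Proof.
move=> defG abQ; apply/eqP.
have defZ := center_dprod defG; rewrite (center_idP abQ) in defZ.
rewrite -(eqn_pmul2l (cardG_gt0 'Z(G))) card_center_quotient.
rewrite -(dprod_card defG) -(dprod_card defZ) mulnAC card_center_quotient.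
by rewrite mulnC.
Qed.

Lemma center_index4_dprod G : ~~ abelian G -> #|G / 'Z(G)| = 4 ->
  exists P Q : {group gT},
    [/\ P \x Q = G, P \in 'Syl_2(G),
        P / 'Z(P) \isog [set: 'Z_2 * 'Z_2] & abelian Q].
Proof.
move=> nabG cGZ.
have pGZ : 2.-group (G / 'Z(G)) by rewrite /pgroup cGZ.
have nilG : nilpotent G by rewrite -quotient_center_nil (pgroup_nil pGZ).
have defG := nilpotent_pcoreC 2 nilG.
(* The image of a 2'-group in the 2-group [G / 'Z(G)] is trivial. *)
have sQZ : 'O_2^'(G) \subset 'Z(G).
  have nZQ := subset_trans (pcore_sub 2^' G) (normal_norm (center_normal G)).
  rewrite -quotient_sub1 // -(setIidPl (quotientS _ (pcore_sub 2^' G))) setIC.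
  rewrite coprime_TIg // (pnat_coprime pGZ) //.
  exact: quotient_pgroup (pcore_pgroup _ _).
have abQ := abelianS sQZ (center_abelian G).
have cPZ : #|'O_2(G) / 'Z('O_2(G))| = 4.
  by rewrite (card_quotient_center_dprod defG abQ).
exists 'O_2(G)%G, 'O_2^'(G)%G; split=> //.
  by rewrite inE (nilpotent_pcore_Hall _ nilG).
apply: isog_Z2xZ2 => //.
apply: contra nabG => /cyclic_center_factor_abelian abP.
by have [_ defPQ cPQ _] := dprodP defG; rewrite -defPQ abelianM abP abQ.
Qed.

(** [A] is the union of two cosets of ['Z(G)], and it is abelian since [A / 'Z(G)] is cyclic. The
    other two cosets are the blocks; the bound on [#|'Z(G)|] gives each of them more than one
    element. *)
Lemma index4_abelian_partition G A t :
    #|G / 'Z(G)| = 4 -> 1 < #|'Z(G)| -> involution_mod_center G t ->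
    A :=: <<'Z(G) :|: [set t]>> ->
  n_abelian_partition 2 G A.
Proof.
move=> cGZ Zgt1 [Gt nZt ot] defA.
have nZG := normal_norm (center_normal G).
have sZA : 'Z(G) \subset A by rewrite defA sub_gen ?subsetUl.
have At : t \in A by rewrite defA mem_gen // !inE eqxx orbT.
have sAG : A \subset G by rewrite defA gen_subG subUset center_sub sub1set.
have eqAZ : A / 'Z(G) = <[coset 'Z(G) t]>.
  have sZtN : 'Z(G) :|: [set t] \subset 'N('Z(G)).
    by apply: subset_trans nZG; rewrite subUset center_sub sub1set.
  rewrite /= defA quotient_gen // quotientU quotient_set1 ?(subsetP nZG) //.
  by rewrite trivg_quotient -joingE -joing_idr joing1G.
have cA : #|A| = (2 * #|'Z(G)|)%N.
  have nZA := subset_trans sAG nZG.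
  by rewrite -(Lagrange sZA) -card_quotient // eqAZ -orderE ot mulnC.
have cG : #|G| = (4 * #|'Z(G)|)%N by rewrite -card_center_quotient cGZ mulnC.
have abA : abelian A.
  apply: (@cyclic_factor_abelian _ 'Z(G)%G).
    by rewrite subsetI sZA (subset_trans (subsetIr G _)) ?centS.
  by rewrite eqAZ cycle_cyclic.
have [x Gx nAx] : exists2 x, x \in G & x \notin A.
  apply/subsetPn; apply/negP => /subset_leq_card.
  by rewrite cA cG leq_pmul2r ?cardG_gt0.
have cZx z : #|'Z(G) :* z| = #|'Z(G)| by rewrite card_rcoset.
(* This union has at most [(2 + 1) * #|'Z(G)|] elements, fewer than [G]. *)
have [y Gy] : exists2 y, y \in G & y \notin A :|: 'Z(G) :* x.
  apply/subsetPn; apply/negP => /subset_leq_card.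
  rewrite leqNgt (leq_ltn_trans (leq_card_setU _ _)) // cA cZx cG.
  by rewrite -[X in _ + X]mul1n -mulnDl ltn_pmul2r ?cardG_gt0.
rewrite inE negb_or => /andP[nAy nZxy].
have disjA z : z \notin A -> [disjoint A & 'Z(G) :* z].
  move=> nAz; rewrite disjoint_sym disjoints_subset.
  apply/subsetP=> _ /rcosetP[c Zc ->].
  by rewrite inE groupMl // (subsetP sZA).
have disjxy : [disjoint 'Z(G) :* x & 'Z(G) :* y].
  rewrite disjoints_subset; apply/subsetP=> u Zxu; rewrite inE.
  apply: contra nZxy => Zyu; rewrite -(rcoset_eqP Zxu) rcoset_sym //.
have comZ z : z \in G -> commuting_set ('Z(G) :* z).
  move=> Gz _ _ /rcosetP[c /centerP[Gc cc] ->] /rcosetP[d /centerP[Gd cd] ->].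
  apply: commuteM; apply: commute_sym; first exact: cd (groupM Gc Gz).
  by apply: commuteM => //; apply: commute_sym (cc z Gz).
split=> //; exists (fun i => 'Z(G) :* (if i == ord0 then x else y)); split.
- by move=> i; apply: comZ; case: ifP.
- by move=> i; rewrite cZx.
- by move=> i; apply: disjA; case: ifP.
- case=> [[|[|i]] ?] [[|[|j]] ?] //= _.
  by rewrite disjoint_sym.
rewrite !big_ord_recl big_ord0 setU0 /=.
have sZzG z : z \in G -> 'Z(G) :* z \subset G.
  by move=> Gz; rewrite mul_subG ?center_sub ?sub1set.
(* All pieces lie in [G] and are disjoint, so it suffices to count: 2 + 1 + 1 = 4 cosets of
   ['Z(G)]. *)
apply/esym/eqP; rewrite eqEcard !subUset sAG !sZzG //= cG.
have disjAxy : A :&: ('Z(G) :* x :|: 'Z(G) :* y) = set0.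
  by rewrite setIUr !disjoint_setI0 ?setU0 ?disjA.
rewrite cardsU disjAxy cards0 subn0 cardsU.
by rewrite (disjoint_setI0 disjxy) cards0 subn0 cA !cZx addnn -mul2n -mulnDl.
Qed.

Lemma abelian_partition_center G A :
    ~~ abelian G -> n_abelian_partition 2 G A ->
  #|G / 'Z(G)| = 4 /\
  exists2 t, involution_mod_center G t & A :=: <<'Z(G) :|: [set t]>>.
Proof.
move=> nabG [_ sAG abA [B [comB _ _ _ defG]]].
pose H i := <<B i>>%G.
have abH i : abelian (H i).
  by rewrite /= abelian_gen; apply/centsP => x Bx y By; exact: (comB i).
have sBG i : B i \subset G.
  by rewrite defG (subset_trans _ (subsetUr _ _)) ?(bigcup_sup i).
have sHG i : H i \subset G by rewrite gen_subG.
have pG (K : {group gT}) : K \subset G -> abelian K -> K \proper G.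
  move=> sKG abK; rewrite properEneq sKG andbT.
  by apply: contraNneq nabG => /= <-.
have pA := pG A sAG abA.
have pH i : H i \proper G by apply: pG.
have coverG : G \subset A :|: H ord0 :|: H (lift ord0 ord0).
  rewrite defG !big_ord_recl big_ord0 setU0 setUA.
  by rewrite !setUSS ?subset_gen.
set H0 := H ord0 in coverG; set H1 := H (lift ord0 ord0) in coverG.
have cG := three_cover_card_group pA (pH _) (pH _) coverG.
have cA := three_cover_card pA (pH _) (pH _) coverG.
have sK1 := three_cover_capS pA (pH _) coverG.
rewrite -/H0 -/H1 in cG cA sK1.
have sKZ : A :&: H0 \subset 'Z(G).
  rewrite subsetI (subset_trans (subsetIl _ _) sAG) /= centsC.
  have cK (X : {group gT}) :
    abelian X -> A :&: H0 \subset X -> X \subset 'C(A :&: H0).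
    by move=> abX sKX; apply: subset_trans abX (centS sKX).
  apply: subset_trans coverG _.
  by rewrite !subUset !cK ?subsetIl ?subsetIr ?abH.
(* Noncommutativity gives the lower bound; the upper one is [cG] with the intersection enlarged to
   ['Z(G)]. *)
have cGZ : #|G / 'Z(G)| = 4.
  apply/eqP; rewrite eqn_leq (card_center_quotient_gt3 nabG) andbT.
  rewrite -(leq_pmul2l (cardG_gt0 'Z(G))) card_center_quotient mulnC.
  by rewrite (leq_trans cG) // leq_pmul2l // subset_leq_card.
split=> //.
have defZ : A :&: H0 = 'Z(G).
  apply/eqP; rewrite eqEcard sKZ -(leq_pmul2l (isT : 0 < 4)).
  by rewrite -{1}cGZ mulnC card_center_quotient.
rewrite defZ in cA.
have sZA : 'Z(G) \subset A by rewrite -defZ subsetIl.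
(* An element outside both generated subgroups must lie in [A], and it avoids the center because
   ['Z(G)] is contained in [H0]. *)
have [t [Gt nH0t nH1t]] :=
  exists_outside_two_subgroups (pH ord0) (pH (lift ord0 ord0)).
have At : t \in A.
  have := subsetP coverG t Gt.
  by rewrite !in_setU (negPf nH0t) (negPf nH1t) !orbF.
have nZt : t \notin 'Z(G) by rewrite -defZ inE negb_and nH0t orbT.
have nZA := subset_trans sAG (normal_norm (center_normal G)).
have cAZ : #|A / 'Z(G)| <= 2.
  rewrite -(leq_pmul2l (cardG_gt0 'Z(G))) card_quotient // Lagrange //.
  by rewrite mulnC.
have sZtA : <<'Z(G) :|: [set t]>> \subset A.
  by rewrite gen_subG subUset sZA sub1set.
exists t.
  (* The coset of [t] has order at most [#|A / 'Z(G)| <= 2], and it is nontrivial since [t] is not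
     central. *)
  split=> //; apply/eqP; rewrite eqn_leq; apply/andP; split.
    apply: leq_trans cAZ; by rewrite subset_leq_card // cycle_subG mem_quotient.
  rewrite ltnNge -trivg_card_le1 cycle_eq1.
  by apply: contra nZt => /eqP/coset_idr-> //; apply: (subsetP nZA).
apply/eqP; rewrite eq_sym eqEcard sZtA (leq_trans cA) //.
have sZZt : 'Z(G) \subset <<'Z(G) :|: [set t]>> by rewrite sub_gen ?subsetUl.
rewrite -(Lagrange sZZt) mulnC leq_pmul2l ?cardG_gt0 // indexg_gt1.
by apply: contra nZt => /subsetP-> //; rewrite mem_gen // !inE eqxx orbT.
Qed.

End CenterIndexFour.

Theorem theorem3p1 (gT : finGroupType) (G A : {group gT})
    (nonabG : ~~ abelian G) :
  n_abelian_partition 2 G A <->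
  (exists P Q : {group gT},
     [/\ P \x Q = G,
         P \in 'Syl_2(G),
         P / 'Z(P) \isog [set: 'Z_2 * 'Z_2],
         abelian Q
       & exists2 t : gT, involution_mod_center G t
                       & A :=: <<'Z(G) :|: [set t]>>]).
Proof.
split=> [partA|[P [Q [defG sylP isoP abQ [t invt defA]]]]].
  have [cGZ tA] := abelian_partition_center nonabG partA.
  have [P [Q [defG sylP isoP abQ]]] := center_index4_dprod nonabG cGZ.
  by exists P, Q.
have cPZ : #|P / 'Z(P)| = 4.
  by rewrite (card_isog isoP) cardsT card_prod !card_ord.
apply: (index4_abelian_partition _ _ invt defA).
  by rewrite -(card_quotient_center_dprod defG abQ).
(* It remains to see that ['Z(G)] is nontrivial: it contains ['Z(P)], and [P] is a 2-group,
   nontrivial because [P / 'Z(P)] has order 4. *)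
have pP : 2.-group P by move: sylP; rewrite inE => /and3P[].
have sZPZ : 'Z(P) \subset 'Z(G).
  by rewrite -(dprodW (center_dprod defG)) mulG_subl.
apply: leq_trans (subset_leq_card sZPZ).
rewrite cardG_gt1; apply/eqP=> /(trivg_center_pgroup pP) P1.
by have := leq_quotient 'Z(P) P; rewrite cPZ P1 cards1.
Qed.
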